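(* Let $K=\sum_{i=1}^n X_i$, where $X_1,\dots,X_n$ are i.i.d. Bernoulli random variables with $\Pr\{X_i=1\}=p=1-\Pr\{X_i=0\}$, $p\in(0,1)$. Let $[a,b]\subset(0,1)$. Suppose that both $L(k)$ and $U(k)$ are monotone functions of $k\in\{0,1,\dots,n\}$. Let $$\mathcal{S}_U=\{U(k)\in(a,b):0\le k\le n\},\qquad \mathcal{S}_L=\{L(k)\in(a,b):0\le k\le n\},$$ $$C(p)=\Pr\{L(K)\le p\le U(K)\mid p\},\quad C_U(p)=\Pr\{L(K)\le p<U(K)\mid p\},\quad C_L(p)=\Pr\{L(K)<p\le U(K)\mid p\}.$$ Then the infimum of $\Pr\{L(K)\le p\le U(K)\mid p\}$ with respect to $p\in[a,b]$ equals the minimum of the set $$\{C(a),\,C(b)\}\cup\{C_U(p):p\in\mathcal{S}_U\}\cup\{C_L(p):p\in\mathcal{S}_L\}.$$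
   Context: $\Pr\{E\mid p\}$ denotes the probability of $E$ when the binomial parameter has value $p$ (not a conditional probability). $L$ and $U$ are real-valued functions of $k$ not depending on $p$. Monotone means either non-decreasing or non-increasing with respect to $k$.
   Formalization: The claim fails if U(k)=a or L(k)=b for some k (n=1, L(0)=0, L(1)=1/2, U=1, [a,b]=[1/4,1/2]). Proved: the printed formula when no U(k)=a and no L(k)=b; and, in all cases, the formula with [a,b) in S_U and (a,b] in S_L. *)

(* Defs.v *)
From HB Require Import structures.
From mathcomp Require Export all_boot all_order all_algebra.
From mathcomp Require Export all_classical all_reals all_analysis.
Export Order.TTheory GRing.Theory Num.Theory.
Export numFieldNormedType.Exports.

Set Implicit Arguments.
Unset Strict Implicit.
Unset Printing Implicit Defensive.

#[export] Set Implicit Arguments.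
#[export] Unset Strict Implicit.
#[export] Unset Printing Implicit Defensive.

Local Open Scope classical_set_scope.
Local Open Scope ring_scope.

Definition mutually_independent (d d' : measure_display) (T : measurableType d)
    (T' : measurableType d') (R : realType) (I : finType)
    (P : probability T R) (X : I -> {RV P >-> T'}) : Prop :=
  forall (J : {set I}) (A : I -> set T'),
    (forall i, i \in J -> measurable (A i)) ->
    P (\bigcap_(i in [set` J]) (X i @^-1` A i)) =
    (\prod_(i in J) P (X i @^-1` A i))%E.

Definition bernoulli_RV (d : measure_display) (T : measurableType d)
    (R : realType) (P : probability T R) (p : R) (X : {RV P >-> nat}) : Prop :=
  P [set w | X w = 1%N] = p%:E /\ P [set w | X w = 0%N] = (1 - p)%:E.

Definition iid_bernoulli (d : measure_display) (T : measurableType d)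
    (R : realType) (n : nat) (P : probability T R) (p : R)
    (X : 'I_n -> {RV P >-> nat}) : Prop :=
  mutually_independent X /\ forall i, bernoulli_RV p (X i).

Definition sample_sum (d : measure_display) (T : measurableType d) (n : nat)
    (X : 'I_n -> {mfun T >-> nat}) (w : T) : nat := (\sum_(i < n) X i w)%N.

Definition monotone_upto (R : realType) (n : nat) (f : nat -> R) : Prop :=
  (forall i j, (i <= j <= n)%N -> f i <= f j) \/
  (forall i j, (i <= j <= n)%N -> f j <= f i).

Definition values_in (R : realType) (n : nat) (f : nat -> R) (A : set R) :
  set R := [set f k | k in [set k | (k <= n)%N]] `&` A.

(* [Pr p] is the probability under the parameter value [p]; the sample space
   and the variables [X i] on it are common to all parameter values. *)
Section coverage.
Context (d : measure_display) (T : measurableType d) (R : realType) (n : nat).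
Context (Pr : R -> probability T R) (X : 'I_n -> {mfun T >-> nat}).
Context (L U : nat -> R).
Let K := sample_sum X.

Definition cov (p : R) : \bar R := Pr p [set w | L (K w) <= p <= U (K w)].
Definition covU (p : R) : \bar R := Pr p [set w | L (K w) <= p < U (K w)].
Definition covL (p : R) : \bar R := Pr p [set w | L (K w) < p <= U (K w)].

(* [A] and [B] select the values of [U] and [L] at which [covU] and [covL] are
   evaluated. Where [cov] is discontinuous, [covU] and [covL] are its right and
   left limits; the endpoint [a] belongs in [A] when [a] is a value of [U], and
   [b] in [B] when [b] is a value of [L]. Otherwise covU a = cov a, resp.
   covL b = cov b, and the open interval ]a, b[ can be used for both. *)
Definition candidates (a b : R) (A B : set R) : set (\bar R) :=
  [set cov a; cov b] `|` covU @` values_in n U A `|` covL @` values_in n L B.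

End coverage.

Definition is_minimum (R : realType) (S : set (\bar R)) (m : \bar R) : Prop :=
  S m /\ lbound S m.

(* Main.v *)
Require Import Defs.
From mathcomp Require Import ring lra zify.
From mathcomp Require polyrcf.

Local Open Scope classical_set_scope.
Local Open Scope ring_scope.

(* Between consecutive values of [L] and [U] the acceptance set
   {k | L k <= p <= U k} does not depend on [p], and by monotonicity it is an
   integer interval {i..j}. The derivative of P(i <= K <= j) telescopes to a
   difference of two Bernstein terms which changes sign at most once, from plus
   to minus; the coverage is therefore quasi-concave on each such gap, and its
   infimum there is the smaller of its one-sided limits, [covU] at the left end
   and [covL] at the right end. *)

(** * Bernstein polynomials and the derivative of their interval sums *)

Definition bern (R : comNzRingType) (n k : nat) : {poly R} :=
  'C(n, k)%:R *: ('X^k * (1 - 'X) ^+ (n - k)).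

Lemma horner_bern (R : comNzRingType) (n k : nat) (x : R) :
  (bern R n k).[x] = 'C(n, k)%:R * (x ^+ k * (1 - x) ^+ (n - k)).
Proof. by rewrite /bern !hornerE. Qed.

Lemma deriv_bern0 (R : comNzRingType) (n : nat) :
  (bern R n.+1 0)^`() = - (n.+1%:R *: bern R n 0).
Proof.
rewrite /bern !bin0 !scale1r !expr0 !mul1r !subn0 deriv_exp /=.
by rewrite !poly.derivE sub0r mulN1r mulNrn scaler_nat.
Qed.

Lemma deriv_bernS (R : comNzRingType) (n k : nat) :
  (bern R n.+1 k.+1)^`() = n.+1%:R *: (bern R n k - bern R n k.+1).
Proof.
rewrite /bern derivZ derivM derivXn deriv_exp !poly.derivE sub0r mulN1r subSS /=.
rewrite scalerBr scalerDr !scalerA -!natrM.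
(* The absorption identities turn [n.+1 * 'C(n, k)] and [n.+1 * 'C(n, k.+1)] into [k.+1] and [n - k]
   times ['C(n.+1, k.+1)], the coefficients produced by differentiation. *)
rewrite (mul_bin_diag n.+1 k) (mul_bin_down n.+1 k.+1) subSS subnS.
rewrite !scaler_nat mulNrn mulrN mulNrn.
by rewrite mulrnAl mulrnAr !mulrnA.
Qed.

Lemma deriv_bern_interval (R : comNzRingType) (n i j : nat) : (i <= j)%N ->
  (\sum_(i <= k < j.+1) bern R n.+1 k)^`() =
  n.+1%:R *: ((if i is h.+1 then bern R n h else 0) - bern R n j).
Proof.
move=> /subnK <-; elim: (j - i)%N => [|l IH].
  rewrite add0n big_nat1; case: i => [|i]; last exact: deriv_bernS.
  by rewrite deriv_bern0 sub0r scalerN.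
rewrite addSn big_nat_recr ?leqW ?leq_addl// derivD IH deriv_bernS.
by rewrite -scalerDr addrA subrK.
Qed.

(* The ratio of the two sides is a constant times a power of [x / (1 - x)]. *)
Lemma bern_cross (R : realFieldType) (n i j : nat) (s t : R) :
    (i <= j <= n)%N -> 0 < s -> s <= t -> t < 1 ->
  (bern R n j).[t] <= (bern R n i).[t] -> (bern R n j).[s] <= (bern R n i).[s].
Proof.
move=> /andP[ij jn] s0 st t1; rewrite !horner_bern.
have E (x : R) : 0 < x -> x < 1 ->
  ('C(n, j)%:R * (x ^+ j * (1 - x) ^+ (n - j)) <=
   'C(n, i)%:R * (x ^+ i * (1 - x) ^+ (n - i))) =
  ('C(n, j)%:R * x ^+ (j - i) <= 'C(n, i)%:R * (1 - x) ^+ (j - i)).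
  move=> x0 x1; have xn0 : 0 < x ^+ i * (1 - x) ^+ (n - j).
    by rewrite mulr_gt0 ?exprn_gt0 ?subr_gt0.
  rewrite -[RHS](ler_pM2r xn0).
  have -> : x ^+ j = x ^+ (j - i) * x ^+ i by rewrite -exprD subnK.
  have -> : (n - i = (j - i) + (n - j))%N by lia.
  by rewrite (exprD (1 - x)); congr (_ <= _); ring.
rewrite !E ?(le_lt_trans st) ?(lt_le_trans s0)// => Ht.
rewrite (le_trans _ (le_trans Ht _))// ler_wpM2l// lerXn2r ?nnegrE//.
- exact: ltW.
- by rewrite (le_trans (ltW s0)).
- by rewrite subr_ge0 ltW.
- by rewrite subr_ge0 (le_trans st)// ltW.
- by rewrite lerD2l lerN2.
Qed.

(** By telescoping this compares two Bernstein terms, and [bern_cross] settles the generic case. If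
    [j > n] the subtracted term vanishes and the derivative is nonnegative throughout; if [i = 0]
    only the negative term is left, so the premise at [t] fails. *)
Lemma deriv_bern_interval_sign (R : realFieldType) (n i j : nat) (s t : R) :
    (i <= j)%N -> 0 < s -> s <= t -> t < 1 ->
  let f := \sum_(i <= k < j.+1) bern R n.+1 k in
  0 <= (f^`()).[t] -> 0 <= (f^`()).[s].
Proof.
move=> ij s0 st t1 /=; rewrite deriv_bern_interval// !hornerZ.
rewrite !pmulr_rge0 ?ltr0n// !hornerD !hornerN !subr_ge0.
have b_ge0 (x : R) k : 0 < x -> x < 1 -> 0 <= (bern R n k).[x].
  by move=> x0 x1; rewrite horner_bern !mulr_ge0 ?ler0n ?exprn_ge0 ?subr_ge0 ?ltW.
have s1 := le_lt_trans st t1; have t0 := lt_le_trans s0 st.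
have [jn|nj] := leqP j n; last first.
  move=> _; rewrite [leLHS]horner_bern bin_small// mul0r.
  by case: i {ij} => [|h]; rewrite ?horner0// b_ge0.
case: i ij => [_|h hj]; last by apply: bern_cross => //; rewrite (ltnW hj).
rewrite !horner0 [X in X <= 0 -> _]horner_bern => bt; exfalso; move: bt.
apply/negP; rewrite -ltNge.
by rewrite !mulr_gt0 ?exprn_gt0 ?subr_gt0 ?ltr0n ?bin_gt0.
Qed.

(** The sign of the derivative at [p] fixes its sign on one whole side of [p], where the mean value
    theorem then compares [p] with that endpoint. *)
Lemma bern_interval_quasiconcave (R : rcfType) (n i j : nat) (s p t : R) :
    (i <= j)%N -> 0 < s -> s < p -> p < t -> t < 1 ->
  let f := \sum_(i <= k < j.+1) bern R n k in
  f.[s] <= f.[p] \/ f.[t] <= f.[p].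
Proof.
(* The derivative formula needs positive degree; in degree 0 every [bern] is constant. *)
case: n => [|n] ij s0 sp pt t1 f.
  left; rewrite /f !horner_sum ler_sum// => k _.
  by rewrite !horner_bern sub0n; case: k => [|k]; rewrite ?bin0n/= ?expr0 ?mul0r.
have [fp|fp] := leP 0 (f^`()).[p].
- left; have [c /[!in_itv]/= /andP[sc cp] E] := polyrcf.poly_mvt f sp.
  rewrite -subr_ge0 E mulr_ge0 ?subr_ge0 ?(ltW sp)//.
  by apply: (deriv_bern_interval_sign ij (lt_trans s0 sc) (ltW cp)) fp; lra.
- right; have [c /[!in_itv]/= /andP[pc ct] E] := polyrcf.poly_mvt f pt.
  rewrite -subr_le0 E mulr_le0_ge0 ?subr_ge0 ?(ltW pt)//.
  (* A nonnegative derivative at [c > p] would propagate back to [p]. *)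
  rewrite leNgt; apply/negP => /ltW fc; move: fp; rewrite ltNge => /negP; apply.
  by apply: (deriv_bern_interval_sign ij _ (ltW pc) _ fc); lra.
Qed.

(** * Binomial probability of a set of indices, as a polynomial in the parameter *)

Definition binpoly (R : comNzRingType) (n : nat) (S : pred nat) : {poly R} :=
  \sum_(k < n.+1 | S k) bern R n k.

(** An order-convex [S] is, within [{0..n}], either empty or the full interval from its least to its
    greatest element, so the interval case applies. *)
Lemma binpoly_quasiconcave (R : rcfType) (n : nat) (S : pred nat) (s p t : R) :
    (forall i j k, (i <= j <= k)%N -> (k <= n)%N -> S i -> S k -> S j) ->
    0 < s -> s < p -> p < t -> t < 1 ->
  (binpoly R n S).[s] <= (binpoly R n S).[p] \/
  (binpoly R n S).[t] <= (binpoly R n S).[p].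
Proof.
move=> convS s0 sp pt t1.
have [/existsP[k0 Sk0]|/existsPn noS] := boolP [exists k : 'I_n.+1, S k]; last first.
  by left; rewrite /binpoly big_pred0 ?horner0// => k; apply/negbTE.
have exS : exists k, (k <= n)%N && S k by exists k0; rewrite -ltnS ltn_ord Sk0.
have [i /andP[iN Si] i_min] := ex_minnP exS.
have ub k : (k <= n)%N && S k -> (k <= n)%N by case/andP.
have [j /andP[jN Sj] j_max] := ex_maxnP exS ub.
have ij : (i <= j)%N by apply: i_min; rewrite jN.
suff -> : binpoly R n S = \sum_(i <= k < j.+1) bern R n k.
  exact: bern_interval_quasiconcave.
rewrite /binpoly big_geq_mkord [RHS](big_ord_widen_cond n.+1)//=.
apply: eq_bigl => k; apply/idP/andP => [Sk|[ik kj]].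
  have kn : (k <= n)%N && S k by rewrite -ltnS ltn_ord Sk.
  by rewrite ltnS i_min ?j_max.
by apply: (convS i k j) => //; rewrite ik.
Qed.

Lemma eq_binpoly (R : comNzRingType) (n : nat) (S S' : pred nat) :
  (forall k, (k <= n)%N -> S k = S' k) -> binpoly R n S = binpoly R n S'.
Proof. by move=> SS'; apply: eq_bigl => k; rewrite SS'// -ltnS. Qed.

(** Groups the subsets of ['I_n] by cardinality, ['C(n, k)] of them for each [k]. Each summand will
    be the probability of one success pattern. *)
Lemma binpolyE (R : comNzRingType) (n : nat) (S : pred nat) (x : R) :
  (binpoly R n S).[x] =
  \sum_(J : {set 'I_n} | S #|J|) x ^+ #|J| * (1 - x) ^+ (n - #|J|).
Proof.
have Jn (J : {set 'I_n}) : (#|J| < n.+1)%N by rewrite ltnS -[leqRHS]card_ord max_card.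
rewrite /binpoly horner_sum (partition_big (fun J => Ordinal (Jn J)) (fun k => S k))//=.
apply: eq_bigr => k Sk; rewrite horner_bern.
rewrite (eq_bigr (fun=> x ^+ k * (1 - x) ^+ (n - k))); last first.
  by move=> J /andP[_ /eqP <-].
rewrite sumr_const mulr_natl; congr (_ *+ _).
rewrite -[n in 'C(n, _)](card_ord n) -card_draws; apply: eq_card => J; rewrite inE unfold_in -val_eqE /=.
by case: eqP => [->|]; rewrite ?Sk ?andbF.
Qed.

Lemma binpoly_predC (R : comNzRingType) (n : nat) (S : pred nat) (x : R) :
  (binpoly R n S).[x] + (binpoly R n (predC S)).[x] = 1.
Proof.
rewrite -hornerD; have -> : binpoly R n S + binpoly R n (predC S) =
  \sum_(k < n.+1) bern R n k by rewrite [RHS](bigID (fun k : 'I_n.+1 => S k)).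
rewrite horner_sum.
(* Binomial theorem for [((1 - x) + x) ^+ n]. *)
rewrite -[RHS](expr1n _ n) -[in RHS](subrK x 1) exprDn.
by apply: eq_bigr => k _; rewrite horner_bern mulr_natl [X in X *+ _]mulrC.
Qed.

(** * The law of the sample sum *)

Lemma measurable_sample_sum (d : measure_display) (T : measurableType d)
    (n : nat) (X : 'I_n -> {mfun T >-> nat}) (S : set nat) :
  measurable [set w | S (sample_sum X w)].
Proof.
rewrite /sample_sum.
have mX (i : 'I_n) (Y : set nat) : measurable [set w | Y (X i w)].
  by rewrite -[X in measurable X]setTI; exact: (measurable_funP (X i)).
(* [S] is generalized because fixing the first variable at [k] shifts the target set for the
   remaining sum by [k]. *)
elim: (index_enum _) S => [|i r IH] S.
  under eq_set do rewrite big_nil.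
  have [S0|S0] := pselect (S 0%N).
    by rewrite (_ : [set _ | _] = setT)//; apply/seteqP; split.
  by rewrite (_ : [set _ | _] = set0)//; apply/seteqP; split.
rewrite (_ : [set w | _] = \bigcup_k ([set w | X i w = k] `&`
    [set w | S (k + \sum_(j <- r) X j w)%N])).
  apply: bigcupT_measurable => k.
  by apply: measurableI; [exact: (mX i [set k])|exact: (IH [set l | S (k + l)%N])].
apply/seteqP; split=> w /=; rewrite big_cons.
  by exists (X i w).
by move=> [k _ [<-]].
Qed.

(* [sample_sum X] may exceed [n] on a null set. Summing over patterns bounds the
   probability of an event and of its complement from below, and these bounds
   already add up to 1. *)
Section binomial_law.
Variables (d : measure_display) (T : measurableType d) (R : realType) (n : nat).
Variables (P : probability T R) (p : R) (X : 'I_n -> {RV P >-> nat}).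
Hypothesis iidX : iid_bernoulli p X.

Definition pattern (J : {set 'I_n}) : set T :=
  [set w | forall i, X i w = (i \in J)].

Lemma patternE (J : {set 'I_n}) :
  pattern J = \bigcap_(i in [set` [set: 'I_n]%SET]) (X i @^-1` [set (i \in J) : nat]).
Proof.
apply/seteqP; split=> w /= wJ i; first by move=> _; exact: wJ.
by apply: wJ; rewrite /= inE.
Qed.

Lemma measurable_pattern (J : {set 'I_n}) : measurable (pattern J).
Proof.
rewrite patternE; apply: fin_bigcap_measurable => // i _.
by rewrite -[X in measurable X]setTI; exact: (measurable_funP (X i)).
Qed.

Lemma pattern_prob (J : {set 'I_n}) :
  P (pattern J) = (p ^+ #|J| * (1 - p) ^+ (n - #|J|))%:E.
Proof.
rewrite patternE iidX.1//.
rewrite (eq_bigr (fun i => (if i \in J then p else 1 - p)%:E)); last first.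
  move=> i _; have [X1 X0] := iidX.2 i.
  by case: ifP => iJ; rewrite -?X1 -?X0.
rewrite prodEFin; congr EFin.
rewrite (eq_bigl predT) => [|i]; last by rewrite inE.
rewrite (bigID [in J]) /=; congr (_ * _).
  by rewrite (eq_bigr (fun=> p)) => [|i ->//]; rewrite prodr_const.
rewrite (eq_bigr (fun=> 1 - p)) => [|i /negbTE->//].
rewrite (eq_bigl [in ~: J]%SET) => [|i]; last by rewrite inE.
by rewrite prodr_const cardsCs finset.setCK card_ord.
Qed.

Lemma sample_sum_pattern (J : {set 'I_n}) (w : T) :
  pattern J w -> sample_sum X w = #|J|.
Proof.
move=> wJ; rewrite /sample_sum (eq_bigr (fun i => (i \in J) : nat)) => [|i _].
  by rewrite -sum1_card [RHS]big_mkcond /=; apply: eq_bigr => i _; case: ifP.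
exact: wJ.
Qed.

Lemma trivIset_pattern (D : set {set 'I_n}) : trivIset D pattern.
Proof.
move=> J J' _ _ [w [wJ wJ']]; apply/setP => i.
by have := wJ i; rewrite (wJ' i); do 2 case: (_ \in _).
Qed.

Lemma le_sample_sum_prob (S : pred nat) :
  ((\sum_(J : {set 'I_n} | S #|J|) p ^+ #|J| * (1 - p) ^+ (n - #|J|))%:E <=
   P [set w | S (sample_sum X w)])%E.
Proof.
rewrite -sumEFin (eq_bigr (fun J => P (pattern J))) => [|J _]; last first.
  by rewrite pattern_prob.
rewrite -big_filter fsbig_seq ?filter_uniq ?index_enum_uniq//.
rewrite -measure_fin_bigcup//; first last.
- by move=> J _; exact: measurable_pattern.
- exact: trivIset_pattern.
apply: le_measure; rewrite ?inE.
- by apply: fin_bigcup_measurable => // J _; exact: measurable_pattern.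
- exact: (measurable_sample_sum X S).
move=> w [J /=]; rewrite mem_filter => /andP[SJ _] wJ.
by rewrite (sample_sum_pattern wJ).
Qed.

Lemma sample_sum_prob (S : pred nat) :
  P [set w | S (sample_sum X w)] = ((binpoly R n S).[p])%:E.
Proof.
have mS : measurable [set w | S (sample_sum X w)].
  exact: (measurable_sample_sum X S).
apply/eqP; rewrite eq_le binpolyE le_sample_sum_prob// andbT -binpolyE.
have /= := le_sample_sum_prob (predC S).
rewrite -[X in X%:E](binpolyE n (predC S)).
have -> : [set w | ~~ S (sample_sum X w)] = ~` [set w | S (sample_sum X w)].
  by apply/seteqP; split=> w /= /negP.
rewrite probability_setC// -(fineK (fin_num_measure P _ mS)) -EFinB !lee_fin.
by move: (binpoly_predC n S p); lra.
Qed.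
End binomial_law.

(** * Neighbours in finite sequences, limits at endpoints, and gaps *)

Lemma seq_has_min (disp : Order.disp_t) (T : orderType disp) (r : seq T) (x : T) :
  x \in r -> exists2 m, m \in r & forall y, y \in r -> (m <= y)%O.
Proof.
elim: r x => // z [_ x _|z' r IH x _].
  by exists z => [|y]; rewrite inE// => /eqP ->.
have [m mr m_min] := IH z' (mem_head _ _).
have [zm|mz] := leP z m.
  by exists z => [|y]; rewrite ?mem_head// inE => /predU1P[->//|/m_min]; apply: le_trans.
exists m => [|y]; first by rewrite inE mr orbT.
by rewrite inE => /predU1P[->|/m_min//]; exact: ltW.
Qed.

Lemma seq_next (disp : Order.disp_t) (T : orderType disp) (r : seq T) (x y : T) :
    y \in r -> (x < y)%O ->
  exists t, [/\ t \in r, (x < t)%O & forall z, z \in r -> (x < z)%O -> (t <= z)%O].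
Proof.
move=> yr xy; have : y \in [seq z <- r | (x < z)%O] by rewrite mem_filter xy.
move=> /seq_has_min[t /[!mem_filter]/andP[xt tr] t_min].
by exists t; split=> // z zr xz; apply: t_min; rewrite mem_filter xz.
Qed.

Lemma seq_prev (disp : Order.disp_t) (T : orderType disp) (r : seq T) (x y : T) :
    y \in r -> (y < x)%O ->
  exists t, [/\ t \in r, (t < x)%O & forall z, z \in r -> (z < x)%O -> (z <= t)%O].
Proof. exact: (@seq_next _ T^d). Qed.

Lemma poly_le_endpoints (R : realType) (q : {poly R}) (s t : R) (m : \bar R) :
    s < t -> (forall y, s < y < t -> (m <= (q.[y])%:E)%E) ->
  (m <= (q.[s])%:E)%E /\ (m <= (q.[t])%:E)%E.
Proof.
move=> st mq; have adherent x :
    (forall e, 0 < e -> exists2 y, s < y < t & `|y - x| < e) -> (m <= (q.[x])%:E)%E.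
  (* [-oo] is trivial and [+oo] is refuted by any interior point; a real bound passes to the limit
     by continuity. *)
  case: m mq => [r| |] mq near_x; rewrite ?leNye//; last first.
    by have [y /mq] := near_x 1 ltr01.
  rewrite leNgt; apply/negP; rewrite lte_fin -subr_gt0 => qr.
  have [e e0 qe] := polyrcf.poly_cont x q qr.
  have [y /mq + /qe] := near_x e e0; rewrite lee_fin ltr_norml; lra.
split; apply: adherent => e e0.
(* Half of the smaller of [e] and the interval length stays both within [e] of the endpoint and
   inside the interval. *)
- exists (s + Num.min e (t - s) / 2); rewrite ?ltr_norml; case: (leP e (t - s)) => ?; lra.
- exists (t - Num.min e (t - s) / 2); rewrite ?ltr_norml; case: (leP e (t - s)) => ?; lra.
Qed.

Lemma monotone_upto_between (R : realType) (n : nat) (f : nat -> R) (i j k : nat) :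
    monotone_upto n f -> (i <= j <= k)%N -> (k <= n)%N ->
  (f i <= f j <= f k) \/ (f k <= f j <= f i).
Proof.
move=> mono /andP[ij jk] kn; have ijn : (i <= j <= n)%N by rewrite ij (leq_trans jk).
have jkn : (j <= k <= n)%N by rewrite jk.
by case: mono => f_mono; [left|right]; rewrite !f_mono.
Qed.

(** A point outside the gap lies at or below [s], or at or above [t], so its order relative to any
    interior point is decided by comparison with [s]. This freezes the acceptance set on a gap. *)
Lemma notin_gap (R : realFieldType) (s t x : R) : s < t -> ~~ (s < x < t) ->
  [/\ (x < t) = (x <= s), (t <= x) = (s < x)
    & forall p, s < p < t -> (x <= p) = (x <= s) /\ (p <= x) = (s < x)].
Proof.
move=> st; rewrite negb_and -!leNgt => /orP[xs|tx].
  rewrite xs [s < x]ltNge xs /=; split=> [||p /andP[sp pt]].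
  - by rewrite (le_lt_trans xs).
  - by apply/negbTE; rewrite -ltNge (le_lt_trans xs).
  - by rewrite (le_trans xs (ltW sp)); split=> //; apply/negbTE; rewrite -ltNge (le_lt_trans xs).
have sx := lt_le_trans st tx.
rewrite sx tx [x <= s]leNgt sx [x < t]ltNge tx /=; split=> // p /andP[sp pt].
by rewrite leNgt (lt_le_trans pt tx) (le_trans (ltW pt) tx).
Qed.

(** * Coverage on a gap between consecutive values of [L] and [U] *)

Section coverage_theory.
Variables (d : measure_display) (T : measurableType d) (R : realType) (n : nat).
Variables (Pr : R -> probability T R) (X : 'I_n -> {mfun T >-> nat}).
Variables (L U : nat -> R).
Hypothesis iidX : forall p : R, 0 < p < 1 -> @iid_bernoulli d T R n (Pr p) p X.
Hypotheses (monoL : monotone_upto n L) (monoU : monotone_upto n U).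

(** The acceptance set immediately to the right of [s]: an index with [U k = s] has already dropped
    out, one with [L k = s] has entered. *)
Let acc (s : R) : pred nat := fun k => L k <= s < U k.

Lemma covU_le_cov (p : R) : (covU Pr X L U p <= cov Pr X L U p)%E.
Proof.
apply: le_measure; rewrite ?inE.
- exact: (measurable_sample_sum X (fun k => L k <= p < U k)).
- exact: (measurable_sample_sum X (fun k => L k <= p <= U k)).
by move=> w /andP[Lp /ltW pU]; rewrite /= Lp.
Qed.

Lemma covL_le_cov (p : R) : (covL Pr X L U p <= cov Pr X L U p)%E.
Proof.
apply: le_measure; rewrite ?inE.
- exact: (measurable_sample_sum X (fun k => L k < p <= U k)).
- exact: (measurable_sample_sum X (fun k => L k <= p <= U k)).
by move=> w /andP[/ltW Lp pU]; rewrite /= Lp.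
Qed.

(** The events may differ where the sum exceeds [n]; the equality of probabilities therefore goes
    through the binomial law, which sees only indices up to [n]. *)
Lemma covU_eq_cov (p : R) : 0 < p < 1 -> (forall k, (k <= n)%N -> U k != p) ->
  covU Pr X L U p = cov Pr X L U p.
Proof.
move=> p01 Up; rewrite /covU /cov.
rewrite (sample_sum_prob (iidX p01) (fun k => L k <= p < U k)).
rewrite (sample_sum_prob (iidX p01) (fun k => L k <= p <= U k)).
by congr (_.[p])%:E; apply: eq_binpoly => k kn; rewrite lt_neqAle eq_sym Up.
Qed.

Lemma covL_eq_cov (p : R) : 0 < p < 1 -> (forall k, (k <= n)%N -> L k != p) ->
  covL Pr X L U p = cov Pr X L U p.
Proof.
move=> p01 Lp; rewrite /covL /cov.
rewrite (sample_sum_prob (iidX p01) (fun k => L k < p <= U k)).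
rewrite (sample_sum_prob (iidX p01) (fun k => L k <= p <= U k)).
by congr (_.[p])%:E; apply: eq_binpoly => k kn; rewrite lt_neqAle Lp.
Qed.

Section gap.
Variables (s t : R).
Hypotheses (s_gt0 : 0 < s) (s_lt_t : s < t) (t_lt1 : t < 1).
Hypothesis gap : forall k, (k <= n)%N -> ~~ (s < L k < t) && ~~ (s < U k < t).

Let q := binpoly R n (acc s).

Lemma covU_gap : covU Pr X L U s = (q.[s])%:E.
Proof.
have s01 : 0 < s < 1 by rewrite s_gt0 (lt_trans s_lt_t).
exact: (sample_sum_prob (iidX s01) (acc s)).
Qed.

Lemma covL_gap : covL Pr X L U t = (q.[t])%:E.
Proof.
have t01 : 0 < t < 1 by rewrite t_lt1 (lt_trans s_gt0).
rewrite /covL (sample_sum_prob (iidX t01) (fun k => L k < t <= U k)).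
congr (_.[t])%:E; apply: eq_binpoly => k /gap /andP[gapL gapU]; rewrite /acc.
by have [-> _ _] := notin_gap s_lt_t gapL; have [_ -> _] := notin_gap s_lt_t gapU.
Qed.

Lemma cov_gap (p : R) : s < p < t -> cov Pr X L U p = (q.[p])%:E.
Proof.
move=> spt; have p01 : 0 < p < 1.
  by have /andP[sp pt] := spt; rewrite (lt_trans s_gt0 sp) (lt_trans pt t_lt1).
rewrite /cov (sample_sum_prob (iidX p01) (fun k => L k <= p <= U k)).
congr (_.[p])%:E; apply: eq_binpoly => k /gap /andP[gapL gapU]; rewrite /acc.
have [_ _ /(_ _ spt)[-> _]] := notin_gap s_lt_t gapL.
by have [_ _ /(_ _ spt)[_ ->]] := notin_gap s_lt_t gapU.
Qed.

Lemma cov_gap_ge (p : R) : s < p < t ->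
  (covU Pr X L U s <= cov Pr X L U p)%E \/ (covL Pr X L U t <= cov Pr X L U p)%E.
Proof.
move=> spt; rewrite covU_gap covL_gap cov_gap// !lee_fin.
have /andP[sp pt] := spt; apply: binpoly_quasiconcave => // i j k ijk kn.
(* Order-convexity of [acc s]: by monotonicity [L j] and [U j] lie between their values at [i] and
   [k], whatever the directions. *)
by have := monotone_upto_between monoL ijk kn;
   have := monotone_upto_between monoU ijk kn; rewrite /acc; lra.
Qed.

(** On the gap the coverage is the polynomial [q], whose endpoint values are [covU] at [s] and
    [covL] at [t]. This handles candidates that are only one-sided limits of the coverage. *)
Lemma gap_le (m : \bar R) :
    (forall p, s < p < t -> (m <= cov Pr X L U p)%E) ->
  (m <= covU Pr X L U s)%E /\ (m <= covL Pr X L U t)%E.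
Proof.
move=> m_le; rewrite covU_gap covL_gap; apply: poly_le_endpoints => // y sy.
by rewrite -cov_gap// m_le.
Qed.

End gap.

(** * The infimum over [[a, b]] compared with the candidates *)

Section infimum.
Variables (a b : R) (A B : set R).
Hypotheses (a_gt0 : 0 < a) (a_le_b : a <= b) (b_lt1 : b < 1).
(** Keeping [A] and [B] abstract covers both forms of the theorem at once. The upper inclusions
    leave room inside [[a, b]] for a right limit at points of [A] and a left limit at points of
    [B]. *)
Hypotheses (A_sub : A `<=` `[a, b[) (B_sub : B `<=` `]a, b]).
Hypotheses (sub_A : `]a, b[ `<=` A) (sub_B : `]a, b[ `<=` B).
Hypothesis A_left : forall k, (k <= n)%N -> a < b -> U k = a -> A a.
Hypothesis B_right : forall k, (k <= n)%N -> a < b -> L k = b -> B b.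

(** The breakpoints. Including [a] and [b] gives every point of []a, b[] a breakpoint on each side
    within [[a, b]]. *)
Let values : seq R :=
  [:: a; b] ++ [seq U k | k <- iota 0 n.+1] ++ [seq L k | k <- iota 0 n.+1].

Let a_val : a \in values. Proof. by rewrite inE eqxx. Qed.
Let b_val : b \in values. Proof. by rewrite !inE eqxx orbT. Qed.
Let U_val k : (k <= n)%N -> U k \in values.
Proof. by move=> kn; rewrite !mem_cat map_f ?orbT// mem_iota. Qed.
Let L_val k : (k <= n)%N -> L k \in values.
Proof. by move=> kn; rewrite !mem_cat (map_f L) ?orbT// mem_iota. Qed.

Lemma valuesP (x : R) : x \in values ->
  [\/ x = a, x = b, exists2 k, (k <= n)%N & U k = x
    | exists2 k, (k <= n)%N & L k = x].
Proof.
rewrite !mem_cat => /or3P[/[!inE]/orP[/eqP->|/eqP->]|/mapP[k + ->]|/mapP[k + ->]].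
- by constructor 1.
- by constructor 2.
- by rewrite mem_iota ltnS => kn; constructor 3; exists k.
- by rewrite mem_iota ltnS => kn; constructor 4; exists k.
Qed.

Let cand := candidates Pr X L U a b A B.
Let infcov := ereal_inf [set cov Pr X L U p | p in `[a, b]].

Lemma infcov_le (p : R) : a <= p <= b -> (infcov <= cov Pr X L U p)%E.
Proof. by move=> pab; apply: ereal_inf_lbound; exists p => //=; rewrite in_itv. Qed.

Lemma infcov_le_cand (m : \bar R) : cand m -> (infcov <= m)%E.
Proof.
move: (a_gt0) (a_le_b) (b_lt1) => a0 ab b1.
case=> [[[->|->]|[p [_ /A_sub /=]]]|[p [_ /B_sub /=]]].
- by apply: infcov_le; rewrite lexx.
- by apply: infcov_le; rewrite lexx andbT.
- rewrite in_itv/= => /andP[ap pb] <-.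
  (* The next breakpoint [t] is at most [b], so the gap after [p] lies in [[a, b]] and the right
     limit [covU p] is bounded below by the infimum. *)
  have [t [_ pt t_min]] := seq_next b_val pb; have tb := t_min _ b_val pb.
  apply: (proj1 (@gap_le p t _ _ _ _ _ _)) => //; try lra.
  + move=> k kn; rewrite -!negb_or; apply/norP; split; apply/negP => /andP[pk].
      by rewrite ltNge t_min// L_val.
    by rewrite ltNge t_min// U_val.
  + by move=> y yt; apply: infcov_le; lra.
- rewrite in_itv/= => /andP[ap pb] <-.
  have [s [_ sp s_max]] := seq_prev a_val ap; have sa := s_max _ a_val ap.
  apply: (proj2 (@gap_le s p _ _ _ _ _ _)) => //; try lra.
  + move=> k kn; apply/andP; split; apply/negP => /andP[+ pk].
      by rewrite ltNge s_max// L_val.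
    by rewrite ltNge s_max// U_val.
  + by move=> y ys; apply: infcov_le; lra.
Qed.

(** If [s] is a value of [U], [covU s] is itself a candidate. Otherwise it equals [cov s], and
    either [s = a], or [s] is a value of [L] and the candidate [covL s] is no larger. *)
Lemma cand_le_covU (s : R) : s \in values -> a <= s < b ->
  exists2 m, cand m & (m <= covU Pr X L U s)%E.
Proof.
move: (a_gt0) (a_le_b) (b_lt1) => a0 ab b1.
move=> s_val sab; have s01 : 0 < s < 1 by lra.
have [/existsP[k /eqP Uk]|/existsPn Us] := boolP [exists k : 'I_n.+1, U k == s].
  have kn : (k <= n)%N by rewrite -ltnS.
  exists (covU Pr X L U s) => //; left; right; exists s => //; split; first by exists k.
  have [sa|sa] := eqVneq s a.
    by rewrite sa; apply: (A_left kn); rewrite -?sa//; lra.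
  by apply: sub_A; rewrite /= in_itv/= lt_neqAle eq_sym sa.
rewrite covU_eq_cov//; last by move=> k kn; have := Us (Ordinal (kn : (k < n.+1)%N)).
have [sa|sa] := eqVneq s a.
  by exists (cov Pr X L U a); [left; left; left|rewrite sa].
have [?|?|[k kn Uk]|[k kn Lk]] := valuesP s_val; [by lra|by lra| |].
  by have := Us (Ordinal (kn : (k < n.+1)%N)); rewrite /= Uk eqxx.
exists (covL Pr X L U s); last exact: covL_le_cov.
right; exists s => //; split; first by exists k.
by apply: sub_B; rewrite /= in_itv/= lt_neqAle eq_sym sa; lra.
Qed.

Lemma cand_le_covL (t : R) : t \in values -> a < t <= b ->
  exists2 m, cand m & (m <= covL Pr X L U t)%E.
Proof.
move: (a_gt0) (a_le_b) (b_lt1) => a0 ab b1.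
move=> t_val tab; have t01 : 0 < t < 1 by lra.
have [/existsP[k /eqP Lk]|/existsPn Lt] := boolP [exists k : 'I_n.+1, L k == t].
  have kn : (k <= n)%N by rewrite -ltnS.
  exists (covL Pr X L U t) => //; right; exists t => //; split; first by exists k.
  have [tb|tb] := eqVneq t b.
    by rewrite tb; apply: (B_right kn); rewrite -?tb//; lra.
  by apply: sub_B; rewrite /= in_itv/= [t < b]lt_neqAle tb; lra.
rewrite covL_eq_cov//; last by move=> k kn; have := Lt (Ordinal (kn : (k < n.+1)%N)).
have [tb|tb] := eqVneq t b.
  by exists (cov Pr X L U b); [left; left; right|rewrite tb].
have [?|?|[k kn Uk]|[k kn Lk]] := valuesP t_val; [by lra|by lra| |]; last first.
  by have := Lt (Ordinal (kn : (k < n.+1)%N)); rewrite /= Lk eqxx.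
exists (covU Pr X L U t); last exact: covU_le_cov.
left; right; exists t => //; split; first by exists k.
by apply: sub_A; rewrite /= in_itv/= [t < b]lt_neqAle tb; lra.
Qed.

Lemma cand_le_cov (p : R) : a <= p <= b ->
  exists2 m, cand m & (m <= cov Pr X L U p)%E.
Proof.
move: (a_gt0) (a_le_b) (b_lt1) => a0 ab b1.
move=> pab.
(* The endpoint [b] is set apart since [cand_le_covU] requires [p < b]. *)
have [->|pb] := eqVneq p b; first by exists (cov Pr X L U b) => //; left; left; right.
have {pb} p_lt_b : p < b by rewrite lt_neqAle pb; lra.
have [p_val|p_val] := boolP (p \in values).
  have [|m cm /le_trans m_le] := cand_le_covU p_val; first by lra.
  by exists m => //; apply: m_le; exact: covU_le_cov.
have a_lt_p : a < p.
  by rewrite lt_neqAle (andP pab).1 andbT; apply: contraNneq p_val => <-.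
(* Here [p] is no breakpoint, so it lies in the gap between its neighbours [s] and [t], where
   quasi-concavity applies. *)
have [s [s_val sp s_max]] := seq_prev a_val a_lt_p; have sa := s_max _ a_val a_lt_p.
have [t [t_val pt t_min]] := seq_next b_val p_lt_b; have tb := t_min _ b_val p_lt_b.
have no_val x : x \in values -> ~~ (s < x < t).
  move=> xv; apply/negP => /andP[sx xt]; have [xp|px|xp] := ltgtP x p.
  - by move: sx; rewrite ltNge s_max.
  - by move: xt; rewrite ltNge t_min.
  - by move: p_val; rewrite -xp xv.
have spt : s < p < t by rewrite sp.
have [|//||k kn|le_p|le_p] := cov_gap_ge _ _ _ _ spt; try lra.
- by rewrite !no_val ?L_val ?U_val.
- by have [|m cm /le_trans m_le] := cand_le_covU s_val; [lra|exists m; rewrite ?m_le].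
- by have [|m cm /le_trans m_le] := cand_le_covL t_val; [lra|exists m; rewrite ?m_le].
Qed.

(** The candidates form a finite nonempty set, hence have a least element [m]. The infimum is below
    every candidate, and every coverage value is above some candidate, so it equals [m]. *)
Lemma infcov_is_minimum : is_minimum cand infcov.
Proof.
have fin_values (f : nat -> R) C : finite_set (values_in n f C).
  by apply: finite_setIl; apply: finite_image; exact: (finite_II n.+1).
have /finite_seqP[r candE] : finite_set cand.
  rewrite !finite_setU; split; [split|]; [by []|exact: finite_image..].
have : cand (cov Pr X L U a) by left; left; left.
rewrite [in X in X -> _]candE => /seq_has_min[m mr m_min].
have cm : cand m by rewrite candE.
suff -> : infcov = m by split=> // y; rewrite candE => /m_min.
apply/eqP; rewrite eq_le infcov_le_cand//=.
apply: le_ereal_inf_tmp => _ [p /= + <-]; rewrite in_itv/= => /cand_le_cov[m'].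
by rewrite candE => /m_min; exact: le_trans.
Qed.

End infimum.
End coverage_theory.

(** If [U k = a], coverage can drop immediately after [a], and if [L k = b], immediately before [b];
    open intervals miss these limits. Hence they are used when no such [k] exists, and half-open
    ones in general. *)
Theorem theorem2 (R : realType) (d : measure_display) (T : measurableType d)
    (n : nat) (Pr : R -> probability T R) (X : 'I_n -> {mfun T >-> nat})
    (L U : nat -> R) (a b : R)
    (iidX : forall p : R, 0 < p < 1 -> @iid_bernoulli d T R n (Pr p) p X)
    (a_gt0 : 0 < a) (a_le_b : a <= b) (b_lt1 : b < 1)
    (monoL : monotone_upto n L) (monoU : monotone_upto n U) :
  ((forall k, (k <= n)%N -> U k <> a /\ L k <> b) ->
   is_minimum (candidates Pr X L U a b `]a, b[ `]a, b[)
     (ereal_inf [set cov Pr X L U p | p in `[a, b]])) /\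
  is_minimum (candidates Pr X L U a b `[a, b[ `]a, b])
    (ereal_inf [set cov Pr X L U p | p in `[a, b]]).
Proof.
have oo_co : `]a, b[ `<=` `[a, b[ by apply: subset_itvr; rewrite bnd_simp.
have oo_oc : `]a, b[ `<=` `]a, b] by apply: subset_itvl; rewrite bnd_simp.
split=> [noval|]; apply: infcov_is_minimum => //.
- by move=> k kn _ Uk; case: (noval k kn).
- by move=> k kn _ Lk; case: (noval k kn).
- by move=> k _ ab _; rewrite /= in_itv/= lexx.
- by move=> k _ ab _; rewrite /= in_itv/= lexx andbT.
Qed.
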